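(* Let $0 < \mu < 1$, let $K \subset \mathbb{R}^d$ be an origin-symmetric convex body and let $\mathcal{F} = \{x_1+\lambda_1 K, x_2+\lambda_2 K, \ldots\}$ be a generalized Minkowski arrangement of order $\mu$, where $x_i \in \mathbb{R}^d$ and $\lambda_i > 0$ for each $i = 1,2,\ldots$. Assume that $\mathcal{F}$ is of positive homogeneity, that is, there are constants $0 < C_1 < C_2$ satisfying $C_1 \leq \lambda_i \leq C_2$ for all values of $i$. Define the (upper) density of $\mathcal{F}$ as \[ \delta(\mathcal{F}) = \limsup_{R\to\infty} \frac{\sum_{x_i \in R\mathbf{B}^d} \operatorname{vol}_d(x_i+\lambda_i K)}{\operatorname{vol}_d(R\mathbf{B}^d)}, \] if it exists. Then \[ \delta(\mathcal{F}) \leq \frac{2^d}{(1+\mu)^d}. \] Moreover, equality is attained, for example, if $\{x_1,x_2,\ldots\}$ is a lattice with $K$ as its fundamental region, and $\lambda_i = 2/(1+\mu)$ for all values of $i$.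
   Context: $\operatorname{vol}_d$ denotes $d$-dimensional volume and $\mathbf{B}^d$ is the closed Euclidean unit ball centered at the origin of $\mathbb{R}^d$. For a centrally symmetric convex body $K'$, its $\mu$-core is the homothetic copy of $K'$ of ratio $\mu$ concentric with $K'$. A family of centrally symmetric convex bodies is a generalized Minkowski arrangement of order $\mu$ if for any two distinct members $K', K''$ of the family, $K'$ does not overlap the $\mu$-core of $K''$ (i.e. they have no common interior point). ''$K$ is a fundamental region of the lattice'' means that the translates of $K$ by the lattice vectors tile $\mathbb{R}^d$. *)

(* Defs.v *)
From HB Require Import structures.
From mathcomp Require Import all_boot all_order all_algebra.
From mathcomp Require Import all_classical all_reals all_analysis.

Set Implicit Arguments.
Unset Strict Implicit.
Unset Printing Implicit Defensive.

Import Order.TTheory GRing.Theory Num.Theory.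
Import numFieldNormedType.Exports.

Local Open Scope classical_set_scope.
Local Open Scope ring_scope.

(* R^d is 'rV[R]_d. Its library norm is the sup norm, which induces the usual
   topology (used for interior and compact); the Euclidean norm is defined
   here. *)
Section Geometry.
Variables (R : realType) (d : nat).
Implicit Types (A K L : set 'rV[R]_d) (u v c x : 'rV[R]_d).

Definition enorm v : R := Num.sqrt (\sum_(j < d) v 0 j ^+ 2).

Definition eball (r : R) : set 'rV[R]_d := [set v | enorm v <= r].

Definition box (a b : 'rV[R]_d) : set 'rV[R]_d :=
  [set v | forall j, a 0 j <= v 0 j <= b 0 j].

(* Lebesgue outer measure of dimension d: the infimum of the total volume of
   the countable covers by closed boxes. It agrees with Lebesgue measure on all
   measurable sets, in particular on convex bodies and balls. It is meant for
   d >= 1: when d = 0 every box is the whole space and has volume 1. *)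
Definition vol A : \bar R :=
  ereal_inf [set (\sum_(0 <= k <oo) (\prod_(j < d) ((p k).2 0 j - (p k).1 0 j))%:E)%E
            | p in [set p : nat -> 'rV[R]_d * 'rV[R]_d |
                     (forall k j, (p k).1 0 j <= (p k).2 0 j) /\
                     A `<=` \bigcup_k box (p k).1 (p k).2]].

Definition convex_body A : Prop :=
  [/\ convex_set A, compact A & interior A !=set0].

Definition symmetric_about c A : Prop :=
  forall z, A z -> A (c - (z - c)).

(* x + l K *)
Definition scaled_copy x (l : R) K : set 'rV[R]_d :=
  [set x + l *: z | z in K].

(* For A symmetric about c, core mu c A is the mu-core of A; a convex body has
   at most one center of symmetry. *)
Definition core (mu : R) c A : set 'rV[R]_d :=
  [set c + mu *: (z - c) | z in A].

Definition overlap A1 A2 : Prop := interior A1 `&` interior A2 !=set0.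

(* F is the family of bodies and c lists their centers. The members are indexed:
   a body listed twice counts as two distinct members. *)
Definition gen_Minkowski_arrangement (I : Type) (mu : R)
    (c : I -> 'rV[R]_d) (F : I -> set 'rV[R]_d) : Prop :=
  (forall i, convex_body (F i) /\ symmetric_about (c i) (F i)) /\
  (forall i j, i <> j -> ~ overlap (F i) (core mu (c j) (F j))).

Definition positive_homogeneity (I : Type) (lam : I -> R) : Prop :=
  exists C1 C2 : R, [/\ 0 < C1, C1 < C2 & forall i, C1 <= lam i <= C2].

(* The limit superior is taken in the extended reals, so it always exists. *)
Definition upper_density (I : choiceType)
    (c : I -> 'rV[R]_d) (F : I -> set 'rV[R]_d) : \bar R :=
  limf_esup (fun r : R =>
    ((\esum_(i in [set i | eball r (c i)]) vol (F i)) / vol (eball r))%E)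
    (pinfty_nbhs R).

(* Full-rank lattice: the integer combinations of the rows of B. *)
Definition is_lattice L : Prop :=
  exists2 B : 'M[R]_d, B \in unitmx &
    L = [set map_mx intr z *m B | z in [set: 'rV[int]_d]].

Definition fundamental_region L K : Prop :=
  \bigcup_(v in L) scaled_copy v 1 K = setT /\
  (forall u v, L u -> L v -> u <> v ->
     ~ overlap (scaled_copy u 1 K) (scaled_copy v 1 K)).

End Geometry.

(* Main.v *)
Require Import Defs.
From HB Require Import structures.
From mathcomp Require Import all_boot all_order all_algebra.
From mathcomp Require Import all_classical all_reals all_analysis.
From mathcomp Require Import measurable_realfun ring lra.

Set Implicit Arguments.
Unset Strict Implicit.
Unset Printing Implicit Defensive.

Import Order.TTheory GRing.Theory Num.Theory.
Import numFieldNormedType.Exports.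

Local Open Scope classical_set_scope.
Local Open Scope ring_scope.

(** Let tau = (1 + mu) / 2, and measure sizes with the norm whose unit ball is
    K. That x_i + lam_i K does not overlap the mu-core of x_j + lam_j K says that
    x_i and x_j are at distance at least lam_i + mu lam_j. Exchanging i and j and
    averaging the two bounds, the distance is at least tau (lam_i + lam_j): the
    homothets x_i + tau lam_i K form a packing (scaled_copies_meet and
    overlap_widen). A packing has density at most 1, and passing from
    x_i + tau lam_i K back to x_i + lam_i K multiplies volumes by
    tau^-d = 2^d / (1 + mu)^d (upper_density_packing_le).

    In the tiling case all sizes are 2 / (1 + mu) = tau^-1, so the same distance
    criterion turns the packing by translates of K into an arrangement. The tiles
    centered in the ball of radius r cover the concentric ball of radius r - C,
    where C bounds K, so their density is at least ((r - C) / r)^d; rescaling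
    the tiles by tau^-1 gives the reverse inequality (upper_density_tiling_ge).

    The volume enters through four properties. It is countably subadditive
    (vol_subset_sigma_subadditive). It is additive on disjoint open sets, by the
    criterion of Caratheodory (vol_disjoint_open). It is homogeneous of degree d
    (vol_scaled_copy). The Euclidean ball has positive finite volume
    (vol_eball1_gt0, vol_eball1_fin_num), which rests on the fact that boxes
    covering the unit cube have total volume at least 1 (weighted_cube_cover). *)

(** * Volume is an outer measure *)

Definition box_volume (R : realType) (d : nat) (p : 'rV[R]_d * 'rV[R]_d) : R :=
  \prod_(j < d) (p.2 0 j - p.1 0 j).

Definition box_cover (R : realType) (d : nat) (A : set 'rV[R]_d)
    (p : nat -> 'rV[R]_d * 'rV[R]_d) : Prop :=
  (forall k j, (p k).1 0 j <= (p k).2 0 j) /\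
  A `<=` \bigcup_k box (p k).1 (p k).2.

Section OuterMeasure.
Context (R : realType) (n : nat).
Implicit Types (A : set 'rV[R]_n.+1) (p : nat -> 'rV[R]_n.+1 * 'rV[R]_n.+1).

Lemma vol_le_cover A p : box_cover A p ->
  (vol A <= \sum_(0 <= k <oo) (box_volume (p k))%:E)%E.
Proof. by move=> Ap; apply: ereal_inf_lbound; exists p. Qed.

Lemma vol_ge A (y : \bar R) :
  (forall p, box_cover A p -> (y <= \sum_(0 <= k <oo) (box_volume (p k))%:E)%E) ->
  (y <= vol A)%E.
Proof. by move=> h; apply: le_ereal_inf_tmp => _ [p Ap <-]; exact: h. Qed.

Lemma box_volume_ge0 (p : 'rV[R]_n.+1 * 'rV[R]_n.+1) :
  (forall j, p.1 0 j <= p.2 0 j) -> 0 <= box_volume p.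
Proof. by move=> h; apply: prodr_ge0 => j _; rewrite subr_ge0. Qed.

Lemma vol_ge0 A : (0 <= vol A)%E.
Proof.
apply: vol_ge => p [ple _]; apply: nneseries_ge0 => k _ _.
by rewrite lee_fin box_volume_ge0.
Qed.

Lemma box_volume_point (a : 'rV[R]_n.+1) : box_volume (a, a) = 0.
Proof. by rewrite /box_volume big_ord_recl /= subrr mul0r. Qed.

Lemma vol0 : vol (set0 : set 'rV[R]_n.+1) = 0%E.
Proof.
apply/eqP; rewrite eq_le vol_ge0 andbT.
apply: (@le_trans _ _ (\sum_(0 <= k <oo) (box_volume (0 : 'rV[R]_n.+1, 0))%:E)%E).
  by apply: (@vol_le_cover set0 (fun=> (0, 0))); split.
by rewrite box_volume_point eseries0.
Qed.

Lemma vol_box_le (a b : 'rV[R]_n.+1) : (forall j, a 0 j <= b 0 j) ->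
  (vol (box a b) <= (box_volume (a, b))%:E)%E.
Proof.
move=> ab.
(* Covers are indexed by the naturals, so the box is followed by degenerate
   ones. *)
pose p k := if k is 0%N then (a, b) else (a, a).
apply: (le_trans (@vol_le_cover _ p _)).
  by split=> [[|k] j //=|v vab]; exists 0%N.
rewrite nneseries_recl//; last first.
  by move=> [|k] _; rewrite lee_fin box_volume_ge0.
rewrite eseries_cond/= eseries0 ?adde0// => -[|k]//= _ _.
by rewrite box_volume_point.
Qed.

(** Near-optimal covers of the pieces, with errors summing to an arbitrarily
    small amount, are merged into one cover along a bijection of the naturals
    with pairs of naturals. *)
Lemma vol_subset_sigma_subadditive A (F : nat -> set 'rV[R]_n.+1) :
  subset_sigma_subadditive (@vol R n.+1) A F.
Proof.
move=> AF; have [[i ioo]|] := pselect (exists i, vol (F i) = +oo%E).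
  rewrite (eseries_pinfty _ _ ioo) ?leey// => k _.
  by rewrite -ltNye (lt_le_trans _ (vol_ge0 _)).
rewrite -forallNE => Foo.
apply/lee_addgt0Pr => e e0.
apply: le_trans (epsilon_trick xpredT (fun k => vol_ge0 (F k)) (ltW e0)).
pose good k p := box_cover (F k) p /\ (\sum_(0 <= i <oo) (box_volume (p i))%:E <=
  vol (F k) + (e / (2 ^ k.+1)%:R)%:E)%E.
have [G PG] : {G & forall k, good k (G k)}.
  apply: (@choice _ _ good) => k.
  have ek : 0 < e / (2 ^ k.+1)%:R by rewrite divr_gt0// ltr0n expn_gt0.
  have fk : vol (F k) \is a fin_num.
    by rewrite ge0_fin_numE ?vol_ge0// lt_neqAle leey andbT; apply/eqP.
  have [_ [p Fp <-] plt] := lb_ereal_inf_adherent ek fk.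
  by exists p; split => //; exact: ltW.
have G_ge0 k i : (0 <= (box_volume (G k i))%:E)%E.
  by rewrite lee_fin box_volume_ge0//; apply: (PG k).1.1.
have /card_esym/ppcard_eqP[f] := card_nat2.
apply: (@le_trans _ _ (\sum_(0 <= k <oo) (box_volume (G (f k).1 (f k).2))%:E)%E).
  apply: (@vol_le_cover _ (fun k => G (f k).1 (f k).2)); split=> [k j|v /AF].
    exact: (PG (f k).1).1.1.
  move=> [k _] /(PG k).1.2 [i _ vi]; exists (f^-1%FUN (k, i)) => //=.
  by rewrite invK ?inE.
rewrite nneseries_esumT//.
rewrite -(reindex_esum setT setT f (fun ki => (box_volume (G ki.1 ki.2))%:E)) //.
rewrite [X in esum X](_ : _ = [set: nat] `*`` (fun=> [set: nat])); last first.
  by apply/seteqP; split.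
rewrite -(@esum_esum R nat nat setT (fun=> setT) (fun k i => (box_volume (G k i))%:E))//.
rewrite -nneseries_esumT; last by move=> k; apply: esum_ge0.
apply: lee_nneseries => [k _ _|k _]; first exact: esum_ge0.
by rewrite -nneseries_esumT//; exact: (PG k).2.
Qed.

HB.instance Definition _ := isSubsetOuterMeasure.Build R 'rV[R]_n.+1
  (@vol R n.+1) vol0 vol_ge0 vol_subset_sigma_subadditive.

(** Cutting every box of a cover along the hyperplane yields covers of the two
    sides of the cut, with the same total volume. *)
Lemma halfspace_caratheodory (j : 'I_n.+1) (c : R) :
  (@vol R n.+1).-caratheodory [set v | v 0 j <= c].
Proof.
apply: le_caratheodory_measurable => X; apply: vol_ge => p [ple Xp].
(* The height of the cut, clamped so that both parts of the box have ordered
   corners even when the hyperplane misses the box. *)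
pose cut (q : 'rV[R]_n.+1 * 'rV[R]_n.+1) :=
  Num.max (q.1 0 j) (Num.min (q.2 0 j) c).
pose ins (v : 'rV[R]_n.+1) t : 'rV[R]_n.+1 :=
  \row_i (if i == j then t else v 0 i).
pose lo k := ((p k).1, ins (p k).2 (cut (p k))).
pose hi k := (ins (p k).1 (cut (p k)), (p k).2).
have cutge k : (p k).1 0 j <= cut (p k) by rewrite le_max lexx.
have cutle k : cut (p k) <= (p k).2 0 j by rewrite ge_max ple ge_min lexx.
have lole k i : (lo k).1 0 i <= (lo k).2 0 i.
  by rewrite /lo /= mxE; case: eqP => [->|_].
have hile k i : (hi k).1 0 i <= (hi k).2 0 i.
  by rewrite /hi /= mxE; case: eqP => [->|_].
have volE k : (box_volume (p k))%:E =
    ((box_volume (lo k))%:E + (box_volume (hi k))%:E)%E.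
  have volD q : box_volume q = (q.2 0 j - q.1 0 j) *
      \prod_(i < n.+1 | i != j) (q.2 0 i - q.1 0 i) by rewrite /box_volume (bigD1 j).
  rewrite -EFinD !volD /lo /hi /= !mxE eqxx.
  under [X in _ = (_ * X + _)%:E]eq_bigr => i /negbTE ij do rewrite mxE ij.
  under [X in _ = (_ + _ * X)%:E]eq_bigr => i /negbTE ij do rewrite mxE ij.
  by rewrite -mulrDl; congr (_ * _)%:E; ring.
under eq_eseriesr do rewrite volE.
rewrite nneseriesD => [|k _ _|k _ _]; try by rewrite lee_fin box_volume_ge0.
apply: leeD; apply: vol_le_cover; split=> // v [Xv /= vc].
  have [k _ vk] := Xp _ Xv; exists k => // i; rewrite /lo /= mxE.
  have /andP[-> le2] := vk i; case: eqP => //= ij; subst i.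
  by rewrite le_max le_min le2 vc orbT.
have [k _ vk] := Xp _ Xv; exists k => // i; rewrite /hi /= mxE.
have /andP[le1 ->] := vk i; rewrite andbT; case: eqP => //= ij; subst i.
by rewrite ge_max le1 ge_min; move/negP: vc; rewrite -ltNge => /ltW ->; rewrite orbT.
Qed.

End OuterMeasure.

(** * Open sets and homothets *)

Lemma caratheodory_bigcup (R : realType) (T : pointedType)
    (mu : {outer_measure set T -> \bar R}) (D : set nat) (F : nat -> set T) :
  (forall i, D i -> mu.-caratheodory (F i)) -> trivIset D F ->
  mu (\bigcup_(i in D) F i) = (\esum_(i in D) mu (F i))%E.
Proof.
move=> mF tF.
rewrite (measure_bigcup (mu : {measure set (caratheodory_type mu) -> \bar R}) D F mF tF).
rewrite nneseries_esum; last by move=> *; exact: outer_measure_ge0.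
by rewrite (_ : [set _ | _] = D)//; apply/seteqP; split=> i /=; rewrite inE.
Qed.

Section Measurability.
Context (R : realType) (n : nat).
Local Notation cara := (caratheodory_type (@vol R n.+1)).

(** Half-open boxes are finite intersections of half-spaces and of complements
    of half-spaces, and those with rational corners form a countable base. *)
Lemma open_measurable_vol (U : set 'rV[R]_n.+1) :
  open U -> measurable (U : set cara).
Proof.
move=> oU.
pose hob (ab : 'rV[rat]_n.+1 * 'rV[rat]_n.+1) : set cara :=
  \bigcap_(j in [set: 'I_n.+1])
    (~` [set v | v 0 j <= ratr (ab.1 0 j)] `&` [set v | v 0 j <= ratr (ab.2 0 j)]).
have mhob ab : measurable (hob ab).
  apply: fin_bigcap_measurable => // j _.
  by apply: measurableI; [apply: measurableC|]; exact: halfspace_caratheodory.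
have -> : U = \bigcup_ab (if `[< hob ab `<=` U >] then hob ab else set0).
  apply/seteqP; split=> [u Uu|u [ab _]]; last by case: asboolP => // h /h.
  have /nbhs_ballP[e /= e0 eU] : nbhs u U by move: oU; rewrite openE => /(_ _ Uu).
  have lt1 j : u 0 j - e < u 0 j by rewrite ltrBlDr ltrDl.
  have lt2 j : u 0 j < u 0 j + e by rewrite ltrDl.
  pose a := \row_j sval (cid (rat_in_itvoo (lt1 j))).
  pose b := \row_j sval (cid (rat_in_itvoo (lt2 j))).
  have aP j : u 0 j - e < ratr (a 0 j) < u 0 j.
    by rewrite mxE; case: cid => q /=; rewrite in_itv.
  have bP j : u 0 j < ratr (b 0 j) < u 0 j + e.
    by rewrite mxE; case: cid => q /=; rewrite in_itv.
  have hu : hob (a, b) u.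
    move=> j _; have /andP[_ au] := aP j; have /andP[ub _] := bP j.
    by split=> /=; [apply/negP; rewrite -ltNge|exact: ltW].
  exists (a, b) => //; case: asboolP => // -[] v hv.
  apply: eU; split=> // i j; rewrite ord1 /ball /=.
  have [/= /negP] := hv j I; rewrite -ltNge => av vb.
  have /andP[ea _] := aP j; have /andP[_ be] := bP j.
  rewrite ltr_distlC; apply/andP; split; first exact: lt_trans av.
  exact: le_lt_trans be.
apply: countable_bigcupT_measurable; first exact: countableP.
by move=> ab; case: ifP.
Qed.

(** The volume half of a packing bound: open sets satisfy the criterion of
    Caratheodory, so their volumes add up to the volume of their union. *)
Lemma vol_disjoint_open (D : set nat) (U : nat -> set 'rV[R]_n.+1)
    (A : set 'rV[R]_n.+1) : (forall i, D i -> open (U i)) -> trivIset D U ->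
  (forall i, D i -> U i `<=` A) ->
  (\esum_(i in D) vol (U i) <= vol A)%E.
Proof.
move=> oU tU UA.
have mU i : D i -> measurable (U i : set cara).
  by move=> Di; apply: open_measurable_vol; exact: oU.
apply: (@le_trans _ _ (vol (\bigcup_(i in D) U i))).
  by rewrite (caratheodory_bigcup (mu := @vol R n.+1) mU tU).
by apply: (le_outer_measure (@vol R n.+1)) => v [i Di /(UA i Di)].
Qed.

Lemma vol_cover (D : set nat) (F : nat -> set 'rV[R]_n.+1)
    (A : set 'rV[R]_n.+1) : A `<=` \bigcup_(i in D) F i ->
  (vol A <= \esum_(i in D) vol (F i))%E.
Proof.
rewrite bigcup_mkcond => AF; apply: le_trans (le_outer_measure (@vol R n.+1) _ _ AF) _.
apply: le_trans (outer_measure_sigma_subadditive (@vol R n.+1) _) _.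
rewrite nneseries_esumT; last by move=> *; exact: vol_ge0.
rewrite [leRHS]esum_mkcond; apply: le_esum => i _.
by case: ifP => // _; rewrite outer_measure0.
Qed.

End Measurability.

Section Scaling.
Context (R : realType) (n : nat).
Implicit Types (A : set 'rV[R]_n.+1) (x : 'rV[R]_n.+1).

Lemma scaled_copyE x (l : R) A v : 0 < l ->
  scaled_copy x l A v <-> A (l^-1 *: (v - x)).
Proof.
move=> l0; split=> [[z Az <-]|Av].
  by rewrite addrAC subrr add0r scalerA mulVf ?gt_eqF// scale1r.
by exists (l^-1 *: (v - x)) => //; rewrite scalerA divff ?gt_eqF// scale1r addrC subrK.
Qed.

Lemma vol_scaled_copy_le x (l : R) A : 0 < l ->
  (vol (scaled_copy x l A) <= (l ^+ n.+1)%:E * vol A)%E.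
Proof.
move=> l0; have ln0 : 0 < l ^+ n.+1 by rewrite exprn_gt0.
rewrite muleC -lee_pdivrMr// muleC; apply: vol_ge => p [ple Ap].
rewrite muleC lee_pdivrMr// muleC -nneseriesZl; last first.
  by move=> k _; rewrite lee_fin box_volume_ge0.
pose q k := (x + l *: (p k).1, x + l *: (p k).2).
under eq_eseriesr => k _.
  rewrite -EFinM (_ : _ * _ = box_volume (q k)); last first.
    have -> : l ^+ n.+1 = \prod_(j < n.+1) l by rewrite prodr_const card_ord.
    rewrite /box_volume -big_split /=.
    by apply: eq_bigr => j _; rewrite !mxE; ring.
  over.
apply: vol_le_cover; split=> [k j|_ [v /Ap[k _ vk] <-]].
  by rewrite !mxE lerD2l ler_pM2l.
by exists k => // j; rewrite !mxE !lerD2l !ler_pM2l.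
Qed.

(** The inequality just proved, applied to the inverse homothety, gives the
    converse one. *)
Lemma vol_scaled_copy x (l : R) A : 0 < l ->
  vol (scaled_copy x l A) = ((l ^+ n.+1)%:E * vol A)%E.
Proof.
move=> l0; apply/eqP; rewrite eq_le vol_scaled_copy_le//=.
have ln0 : 0 < l ^+ n.+1 by rewrite exprn_gt0.
rewrite muleC -lee_pdivlMr// muleC -exprVn.
have li0 : 0 < l^-1 by rewrite invr_gt0.
apply: le_trans (vol_scaled_copy_le (- (l^-1 *: x)) (scaled_copy x l A) li0).
apply: (le_outer_measure (@vol R n.+1)) => v Av; exists (x + l *: v); first by exists v.
by rewrite scalerDr scalerA mulVf ?gt_eqF// scale1r addKr.
Qed.

End Scaling.

(** * The unit cube and the Euclidean ball *)

Section UnitCube.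
Context (R : realType).
Local Notation leb := (@lebesgue_measure R).

(** Induction on the dimension. Slicing at height t in the last coordinate
    keeps the boxes met by the slice; letting weights record which boxes are met
    turns the slice into an instance of the same statement, and integrating the
    resulting inequality over t replaces each indicator by at most the length of
    the corresponding edge. *)
Lemma weighted_cube_cover (d : nat) (a b : nat -> nat -> R) (w : nat -> R) :
  (forall k, 0 <= w k) -> (forall k j, a k j <= b k j) ->
  (forall v : nat -> R, (forall j, 0 <= v j <= 1) ->
    (1 <= \sum_(0 <= k <oo)
            (w k * \prod_(j < d) \1_(`[a k j, b k j]) (v j))%:E)%E) ->
  (1 <= \sum_(0 <= k <oo) (w k * \prod_(j < d) (b k j - a k j))%:E)%E.
Proof.
elim: d w => [|d IH] w w0 ab H.
  have /H : forall j : nat, 0 <= (fun=> 0 : R) j <= 1 by rewrite lexx ler01.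
  under eq_eseriesr do rewrite big_ord0.
  by under [in X in _ -> X]eq_eseriesr do rewrite big_ord0.
pose I k := (`[a k d, b k d]%classic : set R).
pose P k := w k * \prod_(j < d) (b k j - a k j).
have P0 k : 0 <= P k.
  by rewrite mulr_ge0// prodr_ge0// => j _; rewrite subr_ge0.
pose U := (`[0, 1]%classic : set R).
have mU : measurable U by exact: measurable_itv.
have lebU : leb U = 1%:E by rewrite /U lebesgue_measure_itv /= lte_fin ltr01 sube0.
have mI k : measurable (I k) by exact: measurable_itv.
pose f k (t : R) : \bar R := ((P k)%:E * (\1_(I k) t)%:E)%E.
have f0 k t : (0 <= f k t)%E by rewrite mule_ge0// lee_fin.
have mind k : measurable_fun U (EFin \o (\1_(I k) : R -> R)).
  by apply/measurable_EFinP; exact: measurable_indic.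
have mf k : measurable_fun U (f k) by apply: measurable_funeM; exact: mind.
have slice t : U t -> (1 <= \sum_(0 <= k <oo) f k t)%E.
  rewrite /U /= in_itv /= => t01.
  have w'0 k : 0 <= w k * \1_(I k) t by rewrite mulr_ge0.
  have := IH (fun k => w k * \1_(I k) t) w'0 ab.
  have -> : (\sum_(0 <= k <oo) f k t =
      \sum_(0 <= k <oo) (w k * \1_(I k) t * \prod_(j < d) (b k j - a k j))%:E)%E.
    by apply: eq_eseriesr => k _; rewrite /f /P -EFinM mulrAC.
  apply=> v v01.
  have := H (fun j => if j == d then t else v j).
  under eq_eseriesr => k _.
    rewrite big_ord_recr /= eqxx mulrA mulrAC.
    under eq_bigr => j _ do rewrite (ltn_eqF (ltn_ord j)).
    over.
  by apply=> j; case: ifP.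
apply: (@le_trans _ _ (\int[leb]_(t in U) (\sum_(0 <= k <oo) f k t))%E).
  have -> : (1 = \int[leb]_(t in U) (cst 1 t))%E.
    by rewrite integral_cst// [X in (_ * X)%E]lebU mule1.
  apply: ge0_le_integral => //.
  by apply: (ge0_emeasurable_sum (P := xpredT)) => // k _; exact: mf.
rewrite integral_nneseries//.
apply: lee_nneseries => [k _ _|k _]; first exact: integral_ge0.
rewrite /f ge0_integralZl_EFin//; last exact: mind.
have -> : (\int[leb]_(x in U) (\1_(I k) x)%:E = leb (I k `&` U))%E.
  exact: (integral_indic leb mU (mI k)).
rewrite big_ord_recr /= mulrA -/(P k) [leRHS]EFinM.
apply: lee_wpmul2l; first by rewrite lee_fin.
apply: (@le_trans _ _ (leb (I k))); first last.
  rewrite /I lebesgue_measure_itv /=; case: ifP => // _.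
  by rewrite lee_fin subr_ge0.
apply: le_measure; [apply: mem_set|apply: mem_set|exact: subIsetl].
  by apply: measurableI; [exact: mI|exact: mU].
exact: mI.
Qed.

Lemma vol_unit_cube_ge1 (n : nat) : (1 <= vol (box (0 : 'rV[R]_n.+1) (const_mx 1%R)))%E.
Proof.
apply: vol_ge => p [ple Ap].
pose a k j := (p k).1 0 (inord j : 'I_n.+1).
pose b k j := (p k).2 0 (inord j : 'I_n.+1).
have -> : (\sum_(0 <= k <oo) (box_volume (p k))%:E =
    \sum_(0 <= k <oo) (1 * \prod_(j < n.+1) (b k j - a k j))%:E)%E.
  apply: eq_eseriesr => k _; rewrite mul1r; congr EFin.
  by apply: eq_bigr => j _; rewrite /a /b inord_val.
apply: (weighted_cube_cover (w := fun=> 1)) => // [k j|v v01]; first exact: ple.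
have /Ap[k _ vk] : box (0 : 'rV[R]_n.+1) (const_mx 1%R) (\row_j v j).
  by move=> j; rewrite !mxE.
have g0 i : xpredT i -> (0 <= (1 * \prod_(j < n.+1) \1_(`[a i j, b i j]) (v j) : R)%:E)%E.
  by rewrite lee_fin mul1r => _; apply: prodr_ge0.
apply: le_trans (nneseries_lim_ge k.+1 (fun i _ => g0 i)).
rewrite big_nat_recr//= -[leLHS]add0e; apply: leeD.
  by apply: sume_ge0 => i _; exact: g0.
rewrite mul1r big1 // => j _; rewrite indicE mem_set//= in_itv /= /a /b inord_val.
by have := vk j; rewrite mxE.
Qed.

End UnitCube.

Section EuclideanBall.
Context (R : realType) (n : nat).
Implicit Types (u v : 'rV[R]_n.+1).

Lemma eballE (r : R) v : 0 <= r -> eball r v <-> \sum_(j < n.+1) v 0 j ^+ 2 <= r ^+ 2.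
Proof.
move=> r0; rewrite /eball /enorm /=.
have s0 : 0 <= \sum_(j < n.+1) v 0 j ^+ 2 by apply: sumr_ge0 => j _; exact: sqr_ge0.
by rewrite -(ler_sqr (sqrtr_ge0 _) r0) sqr_sqrtr.
Qed.

(** The triangle inequality: apply to each coordinate the convexity of the
    square, with weights r / (r + s) and s / (r + s). *)
Lemma eballD (r s : R) u v : 0 < r -> 0 < s ->
  eball r u -> eball s v -> eball (r + s) (u + v).
Proof.
move=> r0 s0; have rs0 : 0 < r + s by rewrite addr_gt0.
move=> /(eballE _ (ltW r0)) ur /(eballE _ (ltW s0)) vs.
apply/(eballE _ (ltW rs0)).
apply: (@le_trans _ _ ((r + s) * (r^-1 * \sum_(j < n.+1) u 0 j ^+ 2 +
                               s^-1 * \sum_(j < n.+1) v 0 j ^+ 2))).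
  rewrite !mulr_sumr -big_split mulr_sumr; apply: ler_sum => j _ /=; rewrite mxE.
  (* The defect of convexity is a square. *)
  rewrite -subr_ge0.
  have -> : (r + s) * (r^-1 * u 0 j ^+ 2 + s^-1 * v 0 j ^+ 2) - (u 0 j + v 0 j) ^+ 2
     = (s * u 0 j - r * v 0 j) ^+ 2 / (r * s) by field; rewrite !gt_eqF.
  by rewrite divr_ge0 ?sqr_ge0// mulr_ge0// ltW.
rewrite expr2 ler_pM2l//.
have -> : r + s = r^-1 * r ^+ 2 + s^-1 * s ^+ 2 by field; rewrite !gt_eqF.
by rewrite lerD// ler_pM2l ?invr_gt0.
Qed.

Lemma eball_scaled (r : R) : 0 < r ->
  eball r = scaled_copy 0 r (eball 1) :> set 'rV[R]_n.+1.
Proof.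
move=> r0; apply/seteqP.
have E v : \sum_(j < n.+1) (r^-1 *: (v - 0)) 0 j ^+ 2 =
           (\sum_(j < n.+1) v 0 j ^+ 2) / r ^+ 2.
  by rewrite subr0 mulr_suml; apply: eq_bigr => j _; rewrite mxE exprMn exprVn mulrC.
have r20 : 0 < r ^+ 2 by rewrite exprn_gt0.
split=> v.
  move=> /(eballE _ (ltW r0)) h; apply/scaled_copyE => //; apply/eballE => //.
  by rewrite E ler_pdivrMr// expr1n mul1r.
move=> /(scaled_copyE _ _ _ r0)/(eballE _ ler01); rewrite E ler_pdivrMr// expr1n mul1r.
by move=> h; apply/eballE; first exact: ltW.
Qed.

Lemma vol_eball (r : R) : 0 < r ->
  vol (eball r : set 'rV[R]_n.+1) = ((r ^+ n.+1)%:E * vol (eball 1%R : set 'rV[R]_n.+1))%E.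
Proof. by move=> r0; rewrite eball_scaled// vol_scaled_copy. Qed.

Lemma eball_of_coord_le (M : R) v : 0 <= M -> (forall j, `|v 0 j| <= M) ->
  eball (n.+1%:R * M) v.
Proof.
move=> M0 vM; apply/eballE; first by rewrite mulr_ge0.
apply: (@le_trans _ _ (\sum_(j < n.+1) M ^+ 2)).
  by apply: ler_sum => j _; rewrite -real_normK ?num_real// ler_sqr ?nnegrE.
rewrite sumr_const card_ord -[leLHS]mulr_natl exprMn ler_wpM2r ?sqr_ge0//.
by rewrite expr2 ler_peMl// ler1n.
Qed.

(** The cube with edge 1 / (n + 1) lies in the unit ball; this edge serves in
    dimension n + 1 and spares the square root of the sharp constant. *)
Lemma vol_eball1_gt0 : (0 < vol (eball 1%R : set 'rV[R]_n.+1))%E.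
Proof.
have i0 : 0 < (n.+1%:R : R)^-1 by rewrite invr_gt0 ltr0n.
apply: (@lt_le_trans _ _
  (vol (scaled_copy 0 (n.+1%:R)^-1 (box (0 : 'rV[R]_n.+1) (const_mx 1%R))))).
  rewrite vol_scaled_copy// mule_gt0 ?lte_fin ?exprn_gt0//.
  exact: lt_le_trans (vol_unit_cube_ge1 R n).
apply: (le_outer_measure (@vol R n.+1)) => _ [v v01 <-]; rewrite add0r.
have -> : eball 1 = eball (n.+1%:R * (n.+1%:R)^-1) :> set 'rV[R]_n.+1.
  by rewrite divff// pnatr_eq0.
apply: eball_of_coord_le; first exact: ltW.
move=> j; rewrite mxE normrM gtr0_norm// ger_pMr//.
by have := v01 j; rewrite !mxE => /andP[h0 h1]; rewrite ger0_norm.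
Qed.

Lemma vol_eball1_fin_num : vol (eball 1%R : set 'rV[R]_n.+1) \is a fin_num.
Proof.
rewrite ge0_fin_numE ?vol_ge0//.
apply: (@le_lt_trans _ _ (vol (box (const_mx (-1)%R) (const_mx 1%R) : set 'rV[R]_n.+1))).
  apply: (le_outer_measure (@vol R n.+1)) => v; rewrite eballE// => h j.
  rewrite !mxE -ler_norml -[leRHS]normr1 -ler_sqr ?nnegrE//.
  rewrite !real_normK ?num_real//.
  by apply: le_trans h; rewrite (bigD1 j)//= lerDl sumr_ge0// => i _; rewrite sqr_ge0.
apply: le_lt_trans (vol_box_le _) (ltry _) => j.
by rewrite !mxE; lra.
Qed.

End EuclideanBall.

(** * Homothets of a symmetric convex body *)

Section SymmetricBody.
Context (R : realType) (n : nat).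
Implicit Types (A K : set 'rV[R]_n.+1) (x v k : 'rV[R]_n.+1).

Lemma affine_continuous x (l : R) : continuous (fun w : 'rV[R]_n.+1 => x + l *: w).
Proof. by move=> w; exact: (cvgD (cvg_cst x) (@scaler_continuous _ _ l w)). Qed.

Lemma interior_scaled_copy x (l : R) A : 0 < l ->
  (scaled_copy x l A)° = scaled_copy x l A°.
Proof.
move=> l0; apply/seteqP; split=> v.
  move=> Av; apply/scaled_copyE => //.
  pose f w : 'rV[R]_n.+1 := x + l *: w.
  have fv : f (l^-1 *: (v - x)) = v.
    by rewrite /f scalerA divff ?gt_eqF// scale1r addrC subrK.
  have : nbhs (l^-1 *: (v - x)) (f @^-1` scaled_copy x l A).
    by apply: affine_continuous; rewrite -/(f _) fv.
  apply: filterS => w /(scaled_copyE _ _ _ l0).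
  by rewrite /f addrAC subrr add0r scalerA mulVf ?gt_eqF// scale1r.
move=> /(scaled_copyE _ _ _ l0) Av.
have gE w : - (l^-1 *: x) + l^-1 *: w = l^-1 *: (w - x) by rewrite scalerBr addrC.
have : nbhs v ((fun w => - (l^-1 *: x) + l^-1 *: w) @^-1` A).
  by apply: affine_continuous; rewrite gE.
by apply: filterS => w; rewrite /preimage /= gE => /(scaled_copyE _ _ _ l0).
Qed.

Lemma convex_setE K : convex_set K <->
  forall a b (t : R), K a -> K b -> 0 <= t -> t <= 1 -> K (t *: a + (1 - t) *: b).
Proof.
split=> [cK a b t Ka Kb t0 t1|cK a b t]; last first.
  by rewrite !inE => Ka Kb; apply: cK.
by have := cK a b (Itv01 t0 t1); rewrite !inE; apply.
Qed.

Lemma core_scaled_copy (mu l : R) x A :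
  core mu x (scaled_copy x l A) = scaled_copy x (mu * l) A.
Proof.
apply/seteqP; split=> [_ [_ [z Az <-] <-]|_ [z Az <-]].
  by exists z => //; rewrite (addrC x (l *: z)) addrK scalerA.
exists (x + l *: z); first by exists z.
by rewrite (addrC x (l *: z)) addrK scalerA.
Qed.

Lemma symmetric_scaled_copy x (l : R) K : symmetric_about 0 K ->
  symmetric_about x (scaled_copy x l K).
Proof.
move=> sK _ [z Kz <-]; exists (0 - (z - 0)); first exact: sK.
by rewrite subr0 sub0r scalerN (addrC x (l *: z)) addrK.
Qed.

Lemma convex_body_scaled_copy x (l : R) K : 0 < l ->
  convex_body K -> convex_body (scaled_copy x l K).
Proof.
move=> l0 [/convex_setE cK kK [w Kw]]; split.
- apply/convex_setE => _ _ t [a Ka <-] [b Kb <-] t0 t1.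
  exists (t *: a + (1 - t) *: b); first exact: cK.
  by apply/matrixP => i j; rewrite !mxE; ring.
- apply: continuous_compact => //; apply: continuous_subspaceT.
  exact: affine_continuous.
- by exists (x + l *: w); rewrite interior_scaled_copy//; exists w.
Qed.

Lemma convex_body_bounded K : convex_body K ->
  exists2 M : R, 0 < M & forall k, K k -> forall j, `|k 0 j| <= M.
Proof.
move=> [_ /compact_bounded[M [_ bM]] _].
exists (Num.max (M + 1) 1); first by rewrite lt_max ltr01 orbT.
move=> k Kk j; apply: (@le_trans _ _ `|k|).
  by rewrite [leRHS]/(Num.norm _)/= mx_normrE; apply: (le_bigmax _ _ (0, j)).
by apply: bM Kk; rewrite lt_max ltrDl ltr01.
Qed.

Section Fixed.
Variable K : set 'rV[R]_n.+1.
Hypotheses (K_body : convex_body K) (K_sym : symmetric_about 0 K).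

(** The homothety of ratio t fixing the point b maps the body into itself, and
    interior points to interior points. *)
Lemma interior_convex a b (t : R) : K° a -> K b -> 0 < t -> t <= 1 ->
  K° (t *: a + (1 - t) *: b).
Proof.
move=> Ka Kb t0 t1.
have [/convex_setE cK _ _] := K_body.
have : (scaled_copy ((1 - t) *: b) t K)° (t *: a + (1 - t) *: b).
  by rewrite interior_scaled_copy//; exists a => //; rewrite addrC.
apply: interiorS => _ [z Kz <-]; rewrite addrC; apply: cK => //; exact: ltW.
Qed.

Lemma interior_sym a : K° a -> K° (- a).
Proof.
move=> Ka; have : nbhs (- a) ((fun w => 0 + (-1) *: w) @^-1` K).
  by apply: affine_continuous; rewrite add0r scaleN1r opprK.
apply: filterS => z; rewrite /preimage /= add0r scaleN1r => /K_sym.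
by rewrite subr0 sub0r opprK.
Qed.

Lemma interior0 : K° 0.
Proof.
have [_ _ [w Kw]] := K_body.
have := @interior_convex w (- w) 2^-1 Kw (interior_subset (interior_sym Kw)).
rewrite (_ : 2^-1 *: w + _ = 0); last by apply/matrixP => i j; rewrite !mxE; field.
by apply; lra.
Qed.

Lemma interior_shrink k (s : R) : K° k -> 0 < s -> s <= 1 -> K° (s *: k).
Proof.
move=> Kk s0 s1; have := interior_convex Kk (interior_subset interior0) s0 s1.
by rewrite scaler0 addr0.
Qed.

(** For a symmetric convex body the Minkowski difference s K - t K is
    (s + t) K; here for interiors. *)
Lemma interior_sub_scaled (a b : 'rV[R]_n.+1) (s t : R) : K° a -> K° b -> 0 < s -> 0 < t ->
  exists2 k, K° k & s *: a - t *: b = (s + t) *: k.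
Proof.
move=> Ka Kb s0 t0; have st : 0 < s + t by exact: addr_gt0.
exists (s / (s + t) *: a + (1 - s / (s + t)) *: (- b)).
  apply: interior_convex => //.
  - exact: interior_subset (interior_sym Kb).
  - by rewrite divr_gt0.
  - by rewrite ler_pdivrMr// mul1r lerDl ltW.
by apply/matrixP => i j; rewrite !mxE; field; rewrite gt_eqF.
Qed.

(** Interiors of homothets meet exactly when their centers are at distance less
    than s + t in the norm of the body; membership of k in the interior
    expresses this without introducing that norm. *)
Lemma scaled_copies_meet x y (s t : R) : 0 < s -> 0 < t ->
  overlap (scaled_copy x s K) (scaled_copy y t K) <->
  exists2 k, K° k & y - x = (s + t) *: k.
Proof.
move=> s0 t0; rewrite /overlap !interior_scaled_copy//; split.
  move=> [_ [[a Ka <-] [b Kb e]]].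
  have [k Kk ek] := interior_sub_scaled Ka Kb s0 t0.
  exists k => //; rewrite -ek -[y](addrK (t *: b)) e.
  by apply/matrixP => i j; rewrite !mxE; ring.
move=> [k Kk e]; exists (x + s *: k); split; first by exists k.
exists (- k); first exact: interior_sym.
by rewrite -[y](subrK x) e; apply/matrixP => i j; rewrite !mxE; ring.
Qed.

(** Whether homothets with fixed centers overlap depends only on the sum of
    their sizes, monotonically because the body is star-shaped about its center.
    This is what lets a homothet and a core trade sizes. *)
Lemma overlap_widen x y (s t s' t' : R) :
  0 < s -> 0 < t -> 0 < s' -> 0 < t' -> s + t <= s' + t' ->
  overlap (scaled_copy x s K) (scaled_copy y t K) ->
  overlap (scaled_copy x s' K) (scaled_copy y t' K).
Proof.
move=> s0 t0 s'0 t'0 le; rewrite !scaled_copies_meet// => -[k Kk e].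
have h : 0 < s' + t' by exact: addr_gt0.
exists ((s + t) / (s' + t') *: k).
  by apply: interior_shrink => //; rewrite ?divr_gt0 ?addr_gt0// ler_pdivrMr// mul1r.
by rewrite e scalerA mulrCA divff ?gt_eqF// mulr1.
Qed.

End Fixed.
End SymmetricBody.

(** * Limits and sums *)

Section Limits.
Context (R : realType).

(** All limits below are taken through this lemma, with t a ratio of radii or a
    ratio of homothety tending to 1 from below. *)
Lemma le_of_shrunk_le (m : nat) (a b : \bar R) : (0 <= a)%E ->
  (forall t, 0 < t -> t < 1 -> ((t ^+ m)%:E * a <= b)%E) -> (a <= b)%E.
Proof.
have h2 : 0 < (2^-1 : R) < 1 by apply/andP; split; lra.
case: a => [a|_|//]; last first.
  by have /andP[p q] := h2; move=> /(_ _ p q); rewrite gt0_muley// lte_fin exprn_gt0.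
rewrite lee_fin => a0 H.
case: b H => [b||] H; rewrite ?leey//; last first.
  by have /andP[p q] := h2; have := H _ p q.
rewrite lee_fin leNgt; apply/negP => ba.
have c : (t ^+ m * a) @[t --> (1 : R)^'-] --> a.
  rewrite -{2}[a]mul1r -{2}[1](expr1n R m); apply: cvgMl.
  by apply: cvg_at_left_filter; exact: exprn_continuous.
have : \forall t \near (1 : R)^'-, [/\ b < t ^+ m * a, 0 < t & t < 1].
  near=> t; split.
  - by near: t; exact: (cvgr_gt _ c).
  - by near: t; apply: nbhs_left_gt.
  - by near: t; exact: nbhs_left_lt.
move=> /filter_ex[t [+ t0 t1]]; have := H t t0 t1.
by rewrite -EFinM lee_fin leNgt => /negP.
Unshelve. all: by end_near. Qed.

Lemma limf_esup_le (f : R -> \bar R) (b : \bar R) (M : R) :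
  (forall r, M < r -> (f r <= b)%E) -> (limf_esup f (pinfty_nbhs R) <= b)%E.
Proof.
move=> H; rewrite limf_esupE.
apply: (@le_trans _ _ (ereal_sup (f @` [set r | M < r]))).
  by apply: ereal_inf_lbound; exists [set r | M < r] => //; exists M; rewrite num_real.
by apply: ge_ereal_sup => _ [r Mr <-]; exact: H.
Qed.

Lemma limf_esup_ge (f : R -> \bar R) (b : \bar R) (M : R) :
  (forall r, M < r -> (b <= f r)%E) -> (b <= limf_esup f (pinfty_nbhs R))%E.
Proof.
move=> H; rewrite limf_esupE; apply: le_ereal_inf_tmp => _ [V [N [_ NV]] <-].
pose r := Num.max M N + 1.
have Mr : M < r by rewrite ltr_pwDr// le_max lexx.
have Nr : N < r by rewrite ltr_pwDr// le_max lexx orbT.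
apply: le_trans (H r Mr) _; apply: ereal_sup_ubound; exists r => //; exact: NV.
Qed.

Lemma esumZl (D : set nat) (c : R) (a : nat -> \bar R) :
  0 <= c -> (forall i, 0 <= a i)%E ->
  (\esum_(i in D) (c%:E * a i) = c%:E * \esum_(i in D) a i)%E.
Proof.
move=> c0 a0; have D0 i : (0 <= if i \in D then a i else 0)%E by case: ifP.
rewrite esum_mkcond [in RHS]esum_mkcond -(nneseries_esumT D0) -nneseriesZl//.
rewrite -nneseries_esumT => [|i]; last by case: ifP => // _; rewrite mule_ge0.
by apply: eq_eseriesr => i _; case: ifP => // _; rewrite mule0.
Qed.

End Limits.

(** * Density *)

Section Density.
Context (R : realType) (n : nat) (K : set 'rV[R]_n.+1).
Hypotheses (K_body : convex_body K) (K_sym : symmetric_about 0 K).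

(** The center is an interior point, so every ratio below 1 maps the body into
    its interior. *)
Lemma vol_interior : (vol K <= vol K°)%E.
Proof.
apply: (@le_of_shrunk_le _ n.+1); first exact: vol_ge0.
move=> t t0 t1; rewrite -(vol_scaled_copy 0)//.
apply: (le_outer_measure (@vol R n.+1)) => _ [k Kk <-]; rewrite add0r.
have := @interior_convex _ _ K K_body 0 k (1 - t) (interior0 K_body K_sym) Kk.
by rewrite scaler0 add0r (_ : 1 - (1 - t) = t); [apply; lra|lra].
Qed.

Lemma scaled_copy_bounded (L : R) : exists2 C : R, 0 < C &
  forall l k, 0 < l -> l <= L -> K k -> eball C (l *: k).
Proof.
have [M M0 bM] := convex_body_bounded K_body.
pose L' := Num.max L 1; have L'0 : 0 < L' by rewrite lt_max ltr01 orbT.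
exists (n.+1%:R * (L' * M)); first by rewrite mulr_gt0 ?ltr0n ?mulr_gt0.
move=> l k l0 lL Kk; apply: eball_of_coord_le; first by apply/ltW/mulr_gt0.
move=> j; rewrite mxE normrM (gtr0_norm l0); apply: ler_pM => //.
- exact: ltW.
- by rewrite le_max lL.
- exact: bM.
Qed.

Definition density_quotient (x : nat -> 'rV[R]_n.+1) (F : nat -> set 'rV[R]_n.+1)
    (r : R) : \bar R :=
  ((\esum_(i in [set i | eball r (x i)]) vol (F i)) / vol (eball r : set 'rV[R]_n.+1))%E.

Lemma vol_eballE (r : R) : 0 < r ->
  exists2 v : R, 0 < v & vol (eball r : set 'rV[R]_n.+1) = v%:E.
Proof.
move=> r0; have fv := vol_eball1_fin_num R n.
exists (r ^+ n.+1 * fine (vol (eball 1 : set 'rV[R]_n.+1))).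
  by rewrite mulr_gt0 ?exprn_gt0// fine_gt0// vol_eball1_gt0 ltey_eq fv.
by rewrite vol_eball// EFinM fineK.
Qed.

Lemma le_density_quotient x F (c r : R) : 0 < r ->
  (c%:E * vol (eball r : set 'rV[R]_n.+1) <=
     \esum_(i in [set i | eball r (x i)]) vol (F i))%E ->
  (c%:E <= density_quotient x F r)%E.
Proof.
move=> r0; rewrite /density_quotient; have [v v0 ->] := vol_eballE r0.
by rewrite inver gt_eqF// lee_pdivlMr.
Qed.

Lemma density_quotient_le x F (c r : R) : 0 < r ->
  (\esum_(i in [set i | eball r (x i)]) vol (F i) <=
     c%:E * vol (eball r : set 'rV[R]_n.+1))%E ->
  (density_quotient x F r <= c%:E)%E.
Proof.
move=> r0; rewrite /density_quotient; have [v v0 ->] := vol_eballE r0.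
by rewrite inver gt_eqF// lee_pdivrMr.
Qed.

(** The interiors of the bodies of size tau lam_i are disjoint and, when
    centered in the ball of radius r, lie in the ball of radius r + C; the ratio
    of the volumes of these two balls tends to 1. *)
Lemma upper_density_packing_le (mu : R) (x : nat -> 'rV[R]_n.+1) (lam : nat -> R) :
  0 < mu -> (forall i, 0 < lam i) ->
  gen_Minkowski_arrangement mu x (fun i => scaled_copy (x i) (lam i) K) ->
  positive_homogeneity lam ->
  (upper_density x (fun i => scaled_copy (x i) (lam i) K)
     <= (2 ^+ n.+1 / (1 + mu) ^+ n.+1)%:E)%E.
Proof.
move=> mu0 lam0 [_ sep] [C1 [C2 [_ _ lamC]]].
set c := 2 ^+ n.+1 / (1 + mu) ^+ n.+1.
have mu1 : 0 < 1 + mu by rewrite addr_gt0.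
have c0 : 0 < c by rewrite divr_gt0// exprn_gt0.
pose tau := (1 + mu) / 2; have tau0 : 0 < tau by rewrite divr_gt0.
have cE : c * tau ^+ n.+1 = 1.
  rewrite /c /tau expr_div_n mulf_div [X in X / _]mulrC divff//.
  by rewrite mulf_neq0// expf_neq0// gt_eqF.
have taulam0 i : 0 < tau * lam i by rewrite mulr_gt0.
pose U i := (scaled_copy (x i) (tau * lam i) K)°.
(* tau lam_i + tau lam_j is the mean of the two bounds on the distance, hence at
   most the larger one; the condition with the larger bound is the one violated
   by an overlap. *)
have tauD i j : lam i + mu * lam j <= lam j + mu * lam i ->
    tau * lam j + tau * lam i <= lam j + mu * lam i by rewrite /tau; lra.
have apart i j : i <> j -> lam i + mu * lam j <= lam j + mu * lam i ->
    ~ overlap (scaled_copy (x j) (tau * lam j) K) (scaled_copy (x i) (tau * lam i) K).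
  move=> ij le pack; apply: (sep j i); first by move=> ji; exact: ij.
  rewrite core_scaled_copy; apply: overlap_widen pack => //.
    by rewrite mulr_gt0.
  exact: tauD.
have disj : trivIset setT U.
  apply/trivIsetP => i j _ _ /eqP ij; apply: contrapT => /eqP/set0P ne.
  have [le|/ltW le] := lerP (lam i + mu * lam j) (lam j + mu * lam i).
    by apply: (apart i j ij le); rewrite /overlap setIC.
  by apply: (apart j i _ le) => // ji; exact: ij.
have [C Cgt0 CK] := scaled_copy_bounded (tau * C2).
have volF i : (vol (scaled_copy (x i) (lam i) K) <= c%:E * vol (U i))%E.
  rewrite /U interior_scaled_copy// !vol_scaled_copy// muleA -EFinM exprMn mulrA cE mul1r.
  by apply: lee_wpmul2l; [rewrite lee_fin exprn_ge0// ltW|exact: vol_interior].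
have bound r : 0 < r -> (\esum_(i in [set i | eball r (x i)])
    vol (scaled_copy (x i) (lam i) K) <= c%:E * vol (eball (r + C) : set 'rV[R]_n.+1))%E.
  move=> r0.
  apply: (@le_trans _ _ (\esum_(i in [set i | eball r (x i)]) (c%:E * vol (U i)))%E).
    exact: le_esum.
  rewrite esumZl ?(ltW c0)// => [|i]; last exact: vol_ge0.
  apply: lee_wpmul2l; first by rewrite lee_fin ltW.
  apply: vol_disjoint_open.
  - by move=> i _; exact: open_interior.
  - exact: sub_trivIset disj.
  - move=> i xi v /interior_subset [k Kk <-]; apply: eballD => //.
    by apply: CK => //; rewrite ler_pM2l//; case/andP: (lamC i).
apply: (@le_of_shrunk_le _ n.+1).
  apply: limf_esup_ge0 => [|r]; first exact: filter_not_empty.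
  by rewrite mule_ge0 ?inve_ge0 ?vol_ge0// esum_ge0// => i _; exact: vol_ge0.
move=> t t0 t1.
rewrite muleC -lee_pdivlMr ?exprn_gt0// -EFinM.
(* For these radii t (r + C) <= r. *)
apply: (limf_esup_le (M := C / (1 - t))) => r Mr.
have r0 : 0 < r by apply: le_lt_trans Mr; rewrite divr_ge0// ?subr_ge0 ltW.
apply: density_quotient_le => //; apply: le_trans (bound r r0) _.
rewrite (vol_eball _ r0) (vol_eball _ (addr_gt0 r0 Cgt0)) !muleA -!EFinM.
rewrite lee_wpmul2r ?vol_ge0// lee_fin.
have -> : c / t ^+ n.+1 * r ^+ n.+1 = c * (r ^+ n.+1 / t ^+ n.+1).
  by rewrite -mulrA [X in _ * X]mulrC.
rewrite ler_pM2l// ler_pdivlMr ?exprn_gt0// -exprMn.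
rewrite lerXn2r ?nnegrE ?mulr_ge0 ?addr_ge0 ?(ltW r0) ?(ltW Cgt0) ?(ltW t0)//.
by move: Mr; rewrite ltr_pdivrMr ?subr_gt0//; nra.
Qed.

(** The sum of the size of a body and of the size of a core is
    (1 + mu) * (2 / (1 + mu)) = 2, the sum of the sizes of two tiles. *)
Lemma arrangement_of_tiling (mu : R) (x : nat -> 'rV[R]_n.+1) (lam : nat -> R) :
  0 < mu -> injective x -> fundamental_region (range x) K ->
  (forall i, lam i = 2 / (1 + mu)) ->
  gen_Minkowski_arrangement mu x (fun i => scaled_copy (x i) (lam i) K).
Proof.
move=> mu0 xinj [_ tiles] lamE.
have l0 : 0 < 2 / (1 + mu) by rewrite divr_gt0// addr_gt0.
split=> [i|i j ij].
  rewrite lamE; split; first exact: convex_body_scaled_copy.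
  exact: symmetric_scaled_copy.
rewrite core_scaled_copy !lamE => meet.
apply: (tiles (x i) (x j)); [by exists i|by exists j|by move/xinj|].
apply: overlap_widen meet => //; first by rewrite mulr_gt0.
by rewrite le_eqVlt; apply/orP; left; apply/eqP; field; rewrite gt_eqF// addr_gt0.
Qed.

(** A tile meeting the ball of radius r - C has its center in the ball of
    radius r. *)
Lemma upper_density_tiling_ge (l : R) (x : nat -> 'rV[R]_n.+1) :
  0 < l -> \bigcup_(v in range x) scaled_copy v 1 K = setT ->
  ((l ^+ n.+1)%:E <= upper_density x (fun i => scaled_copy (x i) l K))%E.
Proof.
move=> l0 tiles; have ln0 : 0 < l ^+ n.+1 by exact: exprn_gt0.
have [C C0 CK] := scaled_copy_bounded 1.
have cover r : C < r -> ((l ^+ n.+1)%:E * vol (eball (r - C) : set 'rV[R]_n.+1) <=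
    \esum_(i in [set i | eball r (x i)]) vol (scaled_copy (x i) l K))%E.
  move=> Cr; apply: (@le_trans _ _ ((l ^+ n.+1)%:E *
      \esum_(i in [set i | eball r (x i)]) vol (scaled_copy (x i) 1 K))%E).
    apply: lee_wpmul2l; first by rewrite lee_fin ltW.
    apply: vol_cover => v vr.
    have [_ [i _ <-] [k Kk e]] : (\bigcup_(v in range x) scaled_copy v 1 K) v by rewrite tiles.
    exists i; last by exists k.
    rewrite /= (_ : x i = v + 1 *: (- k)); last by rewrite -e scalerN addrK.
    rewrite -[r](subrK C); apply: eballD => //; first by rewrite subr_gt0.
    by apply: CK => //; move: (K_sym Kk); rewrite subr0 sub0r.
  rewrite -esumZl ?(ltW ln0)// => [|i]; last exact: vol_ge0.
  by apply: le_esum => i _; rewrite !vol_scaled_copy// expr1n mul1e.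
apply: (@le_of_shrunk_le _ n.+1); first by rewrite lee_fin ltW.
(* For these radii t r <= r - C. *)
move=> t t0 t1; apply: (limf_esup_ge (M := C / (1 - t))) => r.
rewrite ltr_pdivrMr ?subr_gt0// => Mr.
have r0 : 0 < r by nra.
have Cr : C < r by nra.
rewrite -EFinM; apply: le_density_quotient => //; apply: le_trans (cover r Cr).
have rC0 : 0 < r - C by rewrite subr_gt0.
rewrite (vol_eball _ r0) (vol_eball _ rC0) !muleA -!EFinM.
apply: lee_wpmul2r; first exact: vol_ge0.
rewrite lee_fin mulrAC [leRHS]mulrC ler_pM2r// -exprMn.
rewrite lerXn2r ?nnegrE ?mulr_ge0 ?(ltW r0) ?(ltW rC0) ?(ltW t0)//.
by nra.
Qed.

End Density.

Theorem proposition1 (R : realType) (d : nat) (d_gt0 : (0 < d)%N)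
    (mu : R) (mu_gt0 : 0 < mu) (mu_lt1 : mu < 1)
    (K : set 'rV[R]_d) (K_body : convex_body K) (K_sym : symmetric_about 0 K) :
  (forall (x : nat -> 'rV[R]_d) (lam : nat -> R),
     (forall i, 0 < lam i) ->
     gen_Minkowski_arrangement mu x (fun i => scaled_copy (x i) (lam i) K) ->
     positive_homogeneity lam ->
     (upper_density x (fun i => scaled_copy (x i) (lam i) K)
        <= (2 ^+ d / (1 + mu) ^+ d)%:E)%E) /\
  (forall (x : nat -> 'rV[R]_d) (lam : nat -> R),
     injective x ->
     is_lattice (range x) ->
     fundamental_region (range x) K ->
     (forall i, lam i = 2 / (1 + mu)) ->
     [/\ gen_Minkowski_arrangement mu x (fun i => scaled_copy (x i) (lam i) K),
         positive_homogeneity lam &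
         upper_density x (fun i => scaled_copy (x i) (lam i) K)
           = (2 ^+ d / (1 + mu) ^+ d)%:E]).
Proof.
case: d d_gt0 K K_body K_sym => // n _ K K_body K_sym.
split=> [x lam lam0 arr hom|x lam xinj _ tiling lamE].
  exact: upper_density_packing_le.
have l0 : 0 < 2 / (1 + mu) by rewrite divr_gt0// addr_gt0.
have arr : gen_Minkowski_arrangement mu x (fun i => scaled_copy (x i) (lam i) K).
  exact: arrangement_of_tiling.
have hom : positive_homogeneity lam.
  exists (2 / (1 + mu)), (2 / (1 + mu) + 1); split=> // [|i]; first by rewrite ltrDl.
  by rewrite lamE lexx lerDl ler01.
split=> //; apply/eqP; rewrite eq_le upper_density_packing_le//=; last first.
  by move=> i; rewrite lamE.
rewrite (funext lamE) -expr_div_n; apply: upper_density_tiling_ge => //.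
exact: tiling.1.
Qed.
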